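(* Let $p,q$ be positive integers, and let $\tilde u=(\tilde u_1,\dots,\tilde u_p)\in\mathbb{R}^p_{>0}$ and $\tilde v=(\tilde v_1,\dots,\tilde v_q)\in\mathbb{R}^q_{>0}$ be strictly increasing with $\tilde u_p=\tilde v_q=pq$. Put $\tilde u_0=\tilde v_0=0$, and let $u\in\mathbb{R}^p_{>0}$, $v\in\mathbb{R}^q_{>0}$ be given by $u_i=\tilde u_i-\tilde u_{i-1}$ and $v_j=\tilde v_j-\tilde v_{j-1}$, so that $\sum_{h=1}^q v_h=\sum_{\ell=1}^p u_\ell=pq$. For a function $C_{pq}:I_p\times I_q\to[0,1]$, with $c_{ij}:=C_{pq}(\frac ip,\frac jq)$, the following are equivalent: \begin{enumerate} \item[(i)] $C_{pq}\in\mathrm{ASA}(\tilde u,\tilde v)$ (i.e. $[c_{ij}]\in\mathrm{ASA}(\tilde u,\tilde v)$). \item[(ii)] There is a $p\times q$ alternating transportation matrix $[x_{ij}]\in\mathcal{A}(u,v)$ such that for all $i\in\{0,\dots,p\}$, $j\in\{0,\dots,q\}$ $$c_{ij}=\frac{1}{pq}\sum_{\ell=1}^{i}\sum_{h=1}^{j}x_{\ell h}.$$ \end{enumerate}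
   Context: $I_p:=\{0,\frac1p,\dots,\frac{p-1}{p},1\}$. Empty sums are $0$. $\mathrm{ASA}(\tilde u,\tilde v)$ is the set of matrices $[c_{ij}]\in\mathbb{R}^{(p+1)\times(q+1)}$ (indices $0\le i\le p$, $0\le j\le q$) satisfying (AF1a) $c_{0j}=0$ and $c_{i0}=0$ for all $0\le i\le p$, $0\le j\le q$; (AF1b) $c_{p,j-1}=\frac{\tilde v_{j-1}}{pq}<\frac{\tilde v_j}{pq}=c_{pj}$ for all $1\le j\le q$, and $c_{i-1,q}=\frac{\tilde u_{i-1}}{pq}<\frac{\tilde u_i}{pq}=c_{iq}$ for all $1\le i\le p$ (with $\tilde u_0=\tilde v_0=0$); (AF2b) $c_{i_1j_1}+c_{i_2j_2}-c_{i_1j_2}-c_{i_2j_1}\ge 0$ for all $0\le i_1\le i_2\le p$ and $0\le j_1\le j_2\le q$ such that $i_1=0$, or $i_2=p$, or $j_1=0$, or $j_2=q$. For $u\in\mathbb{R}^p_{>0}$, $v\in\mathbb{R}^q_{>0}$, the alternating transportation polytope $\mathcal{A}(u,v)$ is the set of $[x_{ij}]\in\mathbb{R}^{p\times q}$ such that for all $1\le i\le p$, $1\le j\le q$: $\sum_{\ell=1}^p x_{\ell j}=v_j$; $\sum_{h=1}^q x_{ih}=u_i$; $0\le\sum_{\ell=1}^i x_{\ell j}\le v_j$; and $0\le\sum_{h=1}^j x_{ih}\le u_i$. *)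

(* Defs.v *)
(* MathComp and MathComp-Analysis; R : realType plays the role of the real numbers. *)
From mathcomp Require Import all_boot all_order all_algebra.
From mathcomp Require Import classical_sets reals.

Set Implicit Arguments.
Unset Strict Implicit.
Unset Printing Implicit Defensive.

Import Order.TTheory GRing.Theory Num.Theory.
Local Open Scope ring_scope.

Definition grid (R : realType) (p : nat) : {pred R} :=
  [pred x : R | [exists i : 'I_p.+1, x == i%:R / p%:R]].
Arguments grid : clear implicits.

Definition gridType (R : realType) (p : nat) : Type := {x : R | x \in grid R p}.

Lemma mem_grid (R : realType) (p : nat) (i : 'I_p.+1) :
  (i%:R / p%:R : R) \in grid R p.
Proof. by rewrite inE; apply/existsP; exists i. Qed.

Definition gridpt (R : realType) (p : nat) (i : 'I_p.+1) : gridType R p :=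
  exist _ (i%:R / p%:R) (mem_grid R i).
Arguments gridpt R [p] i.

Definition unitType (R : realType) : Type := {z : R | 0 <= z <= 1}.

Definition samples (R : realType) (p q : nat)
    (C : gridType R p * gridType R q -> unitType R) : 'M[R]_(p.+1, q.+1) :=
  \matrix_(i, j) sval (C (gridpt R i, gridpt R j)).

(* A vector (a_1, ..., a_n) is w : 'rV_n with a_(k+1) = w 0 k; ext0 w adds
   a_0 = 0, so that ext0 w i = a_i for all 0 <= i <= n.
   In 'I_n.+1, the 1-based index k+1 is lift ord0 k and its predecessor k is
   widen_ord (leqnSn n) k. *)
Definition ext0 (R : realType) (n : nat) (w : 'rV[R]_n) (i : 'I_n.+1) : R :=
  if unlift ord0 i is Some k then w 0 k else 0.

Definition increments (R : realType) (n : nat) (w : 'rV[R]_n) : 'rV[R]_n :=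
  \row_k (ext0 w (lift ord0 k) - ext0 w (widen_ord (leqnSn n) k)).

Definition AF1a (R : realType) (p q : nat) (c : 'M[R]_(p.+1, q.+1)) : Prop :=
  (forall j, c ord0 j = 0) /\ (forall i, c i ord0 = 0).

Definition AF1b (R : realType) (p q : nat) (tu : 'rV[R]_p) (tv : 'rV[R]_q)
    (c : 'M[R]_(p.+1, q.+1)) : Prop :=
  (forall k : 'I_q,
     let j' := widen_ord (leqnSn q) k in let j := lift ord0 k in
     [/\ c ord_max j' = ext0 tv j' / (p * q)%:R,
         ext0 tv j' / (p * q)%:R < ext0 tv j / (p * q)%:R
       & ext0 tv j / (p * q)%:R = c ord_max j]) /\
  (forall k : 'I_p,
     let i' := widen_ord (leqnSn p) k in let i := lift ord0 k in
     [/\ c i' ord_max = ext0 tu i' / (p * q)%:R,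
         ext0 tu i' / (p * q)%:R < ext0 tu i / (p * q)%:R
       & ext0 tu i / (p * q)%:R = c i ord_max]).

Definition AF2b (R : realType) (p q : nat) (c : 'M[R]_(p.+1, q.+1)) : Prop :=
  forall (i1 i2 : 'I_p.+1) (j1 j2 : 'I_q.+1),
    (i1 <= i2)%N -> (j1 <= j2)%N ->
    [\/ i1 = ord0, i2 = ord_max, j1 = ord0 | j2 = ord_max] ->
    0 <= c i1 j1 + c i2 j2 - c i1 j2 - c i2 j1.

Definition ASA (R : realType) (p q : nat) (tu : 'rV[R]_p) (tv : 'rV[R]_q) :
    set 'M[R]_(p.+1, q.+1) :=
  fun c => [/\ AF1a c, AF1b tu tv c & AF2b c].

(* The 1-based prefix sum up to index k+1 is the sum over l <= k here. *)
Definition alt_transportation (R : realType) (p q : nat)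
    (u : 'rV[R]_p) (v : 'rV[R]_q) : set 'M[R]_(p, q) :=
  fun x => forall (i : 'I_p) (j : 'I_q),
    [/\ \sum_(l < p) x l j = v 0 j,
        \sum_(h < q) x i h = u 0 i,
        0 <= \sum_(l < p | (l <= i)%N) x l j <= v 0 j
      & 0 <= \sum_(h < q | (h <= j)%N) x i h <= u 0 i].

(* Main.v *)
(* The matrix x is forced to be pq times the mixed second difference of c.
   Its partial column sums are then first differences of c along a row,
   sum_(l <= i) x_lj = pq (c_ij - c_i,j-1), and symmetrically for partial row
   sums.  The bounds defining A(u, v) thus say that c_ij and c_pj - c_ij are
   nondecreasing in j (and likewise in i), which is AF2b. *)
Require Import Defs.
From mathcomp Require Import all_boot all_order all_algebra.
From mathcomp Require Import classical_sets reals.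
From mathcomp Require Import lra.

Set Implicit Arguments.
Unset Strict Implicit.
Unset Printing Implicit Defensive.

Import Order.TTheory GRing.Theory Num.Theory.
Local Open Scope ring_scope.

Lemma telescope_ord (V : zmodType) (n : nat) (f : 'I_n.+1 -> V) (i : 'I_n.+1) :
  \sum_(l < n | (l < i)%N) (f (lift ord0 l) - f (widen_ord (leqnSn n) l))
    = f i - f ord0.
Proof.
have le_in : (i <= n)%N by rewrite -ltnS.
(* Pass to a sum over naturals, where telescoping is available; every index stays at most [n], so
   [inord] never falls back to its default. *)
transitivity (\sum_(0 <= l < i) (f (inord l.+1) - f (inord l))).
  rewrite big_mkord (big_ord_widen _ (fun l => f (inord l.+1) - f (inord l)) le_in).
  apply: eq_bigr => l _; congr (f _ - f _); apply: val_inj => /=.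
    by rewrite inordK ?ltnS.
  by rewrite inordK // ltnS ltnW.
rewrite (telescope_sumr (fun l => f (inord l))) // inord_val.
by congr (_ - f _); apply: val_inj; rewrite /= inordK.
Qed.

(** Inverse to telescoping: it recovers the partial sums of [x] from the double sums that define
    [c]. *)
Lemma sum_ltn_step (V : zmodType) (n : nat) (F : 'I_n -> V) (k : 'I_n) :
  \sum_(h < n | (h < lift ord0 k)%N) F h
    - \sum_(h < n | (h < widen_ord (leqnSn n) k)%N) F h = F k.
Proof.
rewrite (bigD1 k) /=; last by rewrite /bump /= add1n.
rewrite (eq_bigl (fun h : 'I_n => (h < k)%N)) ?addrK // => h.
by rewrite /bump /= add1n ltnS ltn_neqAle andbC.
Qed.

(** Telescoped from [ord0], a larger endpoint only adds nonnegative steps. *)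
Lemma ord_nondecreasing (R : numDomainType) (n : nat) (f : 'I_n.+1 -> R) :
  (forall k : 'I_n, f (widen_ord (leqnSn n) k) <= f (lift ord0 k)) ->
  forall j1 j2 : 'I_n.+1, (j1 <= j2)%N -> f j1 <= f j2.
Proof.
move=> f_step j1 j2 le_j; rewrite -(lerD2r (- f ord0)) -!telescope_ord.
rewrite [leLHS]big_mkcond [leRHS]big_mkcond; apply: ler_sum => l _.
case: ltnP => [lt_l | _]; first by rewrite (leq_trans lt_l le_j).
by case: ifP => // _; rewrite subr_ge0.
Qed.

Lemma ext0_0 (R : realType) (n : nat) (w : 'rV[R]_n) : ext0 w ord0 = 0.
Proof. by rewrite /ext0 unlift_none. Qed.

Lemma ext0_lift (R : realType) (n : nat) (w : 'rV[R]_n) (k : 'I_n) :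
  ext0 w (lift ord0 k) = w 0 k.
Proof. by rewrite /ext0 liftK. Qed.

(** The first step starts at the added value 0, so it is positivity of [w]; all later steps are
    monotonicity. *)
Lemma ext0_step_lt (R : realType) (n : nat) (w : 'rV[R]_n) :
  (forall k : 'I_n, 0 < w 0 k) ->
  (forall k k' : 'I_n, (k < k')%N -> w 0 k < w 0 k') ->
  forall k : 'I_n, ext0 w (widen_ord (leqnSn n) k) < ext0 w (lift ord0 k).
Proof.
move=> w_gt0 w_incr k; rewrite ext0_lift.
case: (unliftP ord0 (widen_ord (leqnSn n) k)) => [j|] e; rewrite e.
  by rewrite ext0_lift; apply: w_incr; move/(congr1 val): e => /= ->.
by rewrite ext0_0.
Qed.

(* AF1b and AF2b are, up to transposing c, two copies of the left-hand side;
   alt_transportation is likewise two copies of the right-hand side. *)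
Lemma column_conditions (R : realType) (m n : nat) (N : R)
    (c : 'M[R]_(m.+1, n.+1)) (w : 'rV[R]_n) :
  (0 < m)%N -> 0 < N ->
  (forall j, c ord0 j = 0) -> c ord_max ord0 = 0 ->
  (forall k : 'I_n, ext0 w (widen_ord (leqnSn n) k) < ext0 w (lift ord0 k)) ->
  let d i k := N * (c i (lift ord0 k) - c i (widen_ord (leqnSn n) k)) in
  ((forall k : 'I_n,
      let j' := widen_ord (leqnSn n) k in let j := lift ord0 k in
      [/\ c ord_max j' = ext0 w j' / N, ext0 w j' / N < ext0 w j / N
        & ext0 w j / N = c ord_max j]) /\
   (forall (i1 i2 : 'I_m.+1) (j1 j2 : 'I_n.+1), (i1 <= i2)%N -> (j1 <= j2)%N ->
      i1 = ord0 \/ i2 = ord_max ->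
      0 <= c i1 j1 + c i2 j2 - c i1 j2 - c i2 j1))
  <-> (forall (i : 'I_m) (k : 'I_n),
         d ord_max k = increments w 0 k /\
         0 <= d (lift ord0 i) k <= increments w 0 k).
Proof.
move=> m_gt0 N_gt0 c0 cmax0 w_step d.
have N_neq0 : N != 0 by rewrite gt_eqF.
split=> [[c_max c_incr] i k | d_bounds].
  have dmax : d ord_max k = increments w 0 k.
    have [cw _ cl] := c_max k.
    by rewrite /d cw -cl mxE -mulrBl mulrC divfK.
  have le_k : (widen_ord (leqnSn n) k <= lift ord0 k)%N by rewrite /= /bump add1n.
  split=> //; rewrite -dmax /d (pmulr_rge0 _ N_gt0) (ler_pM2l N_gt0).
  (* The lower bound is the case [i1 = ord0], as row 0 vanishes; the upper bound is the case
     [i2 = ord_max]. *)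
  apply/andP; split.
    have := c_incr ord0 (lift ord0 i) _ _ (leq0n _) le_k (or_introl erefl).
    by rewrite !c0 add0r subr0.
  have := c_incr (lift ord0 i) ord_max _ _ (leq_ord _) le_k (or_intror erefl).
  by move=> ?; lra.
(* The equality is free of the row index but quantified over it; [m_gt0] supplies a row. *)
have d_max k : d ord_max k = increments w 0 k.
  by have [] := d_bounds (Ordinal m_gt0) k.
(* [d_bounds] omits row 0, where [d] is 0 and the increment of [w] is positive. *)
have d_all i k : 0 <= d i k <= d ord_max k.
  case: (unliftP ord0 i) => [i'|] ->.
    by rewrite d_max; have [] := d_bounds i' k.
  by rewrite d_max /d !c0 subrr mulr0 lexx mxE subr_ge0 ltW.
have c_max j : c ord_max j = ext0 w j / N.
  apply: (canRL (mulfK N_neq0)); rewrite -[RHS]subr0 -[X in _ - X](ext0_0 w).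
  rewrite -telescope_ord -[c _ j]subr0 -[X in _ - X]cmax0.
  rewrite -(telescope_ord (c ord_max)) mulr_suml; apply: eq_bigr => k _.
  by have := d_max k; rewrite mxE mulrC.
split=> [k /=|i1 i2 j1 j2 le_i le_j i12].
  by rewrite !c_max ltr_pM2r ?invr_gt0.
(* It remains to see that the difference of rows [i2] and [i1] is nondecreasing along the columns,
   which needs checking only for adjacent ones. *)
suff : c i2 j1 - c i1 j1 <= c i2 j2 - c i1 j2 by lra.
apply: (ord_nondecreasing (f := fun j => c i2 j - c i1 j)) => // k.
suff : d i1 k <= d i2 k by rewrite /d (ler_pM2l N_gt0); lra.
case: i12 => ->; last by have /andP[] := d_all i1 k.
by rewrite {1}/d !c0 subrr mulr0; have /andP[] := d_all i2 k.
Qed.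

(** Serves both directions of the theorem: the two sum identities tying [x] to [c] come from
    telescoping when [x] is built from [c], and from differencing double sums when [c] is given by
    [x]. *)
Lemma ASA_alt_transportation (R : realType) (p q : nat)
    (tu : 'rV[R]_p) (tv : 'rV[R]_q) (c : 'M[R]_(p.+1, q.+1)) (x : 'M[R]_(p, q)) :
  (0 < p)%N -> (0 < q)%N ->
  (forall k : 'I_p, ext0 tu (widen_ord (leqnSn p) k) < ext0 tu (lift ord0 k)) ->
  (forall k : 'I_q, ext0 tv (widen_ord (leqnSn q) k) < ext0 tv (lift ord0 k)) ->
  AF1a c ->
  (forall (i : 'I_p.+1) k, \sum_(l < p | (l < i)%N) x l k =
     (p * q)%:R * (c i (lift ord0 k) - c i (widen_ord (leqnSn q) k))) ->
  (forall (j : 'I_q.+1) k, \sum_(h < q | (h < j)%N) x k h =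
     (p * q)%:R * (c (lift ord0 k) j - c (widen_ord (leqnSn p) k) j)) ->
  ASA tu tv c <-> alt_transportation (increments tu) (increments tv) x.
Proof.
move=> hp hq tu_step tv_step c0 x_col x_row.
have N_gt0 : 0 < (p * q)%:R :> R by rewrite ltr0n muln_gt0 hp.
have [c0r c0c] := c0.
have colE := column_conditions hp N_gt0 c0r (c0c _) tv_step.
have cT0 j : c^T ord0 j = 0 by rewrite mxE.
have cTmax0 : c^T ord_max ord0 = 0 by rewrite mxE.
have rowE := column_conditions hq N_gt0 cT0 cTmax0 tu_step.
(* Full sums and prefix sums with [<=] are brought to the strict form of [x_col] and [x_row]; the
   bound [l <= i] becomes [l < i + 1]. *)
have sum_max n (F : 'I_n -> R) :
    \sum_(l < n) F l = \sum_(l < n | (l < @ord_max n)%N) F l.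
  by apply: eq_bigl => l; rewrite ltn_ord.
have sum_le n (F : 'I_n -> R) (i : 'I_n) :
    \sum_(l < n | (l <= i)%N) F l = \sum_(l < n | (l < lift ord0 i)%N) F l.
  by apply: eq_bigl => l; rewrite /= /bump add1n ltnS.
split=> [[_ [cv cu] c_incr] i j | x_alt].
  rewrite !sum_le !sum_max !x_col !x_row.
  (* The first two boundary cases of [AF2b] feed the column conditions; the last two feed the row
     conditions, read on the transpose. *)
  have [|-> ->] := (colE.1 _) i j.
    split=> // i1 i2 j1 j2 le_i le_j i12; apply: c_incr => //.
    by case: i12; [constructor 1 | constructor 2].
  have [|] := (rowE.1 _) j i; last by rewrite !mxE => -> ->.
  split=> [k /=|j1 j2 i1 i2 le_j le_i j12].
    by have := cu k; rewrite !mxE.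
  rewrite !mxE.
  have := c_incr i1 i2 j1 j2 le_i le_j.
  case: j12 => e c_ge0; [have := c_ge0 (Or43 _ _ _ e)|have := c_ge0 (Or44 _ _ _ e)]; lra.
have [|cv cv_incr] := colE.2.
  move=> i k; have [+ _ + _] := x_alt i k.
  by rewrite sum_le sum_max !x_col.
have [|cu cu_incr] := rowE.2.
  move=> j k; have [_ + _ +] := x_alt k j.
  by rewrite sum_le sum_max !x_row !mxE.
split=> //; first by split=> [|k /=]; [exact: cv | have /= := cu k; rewrite !mxE].
move=> i1 i2 j1 j2 le_i le_j [] e.
- by apply: cv_incr; auto.
- by apply: cv_incr; auto.
- have := cu_incr j1 j2 i1 i2 le_j le_i (or_introl e); rewrite !mxE; lra.
- have := cu_incr j1 j2 i1 i2 le_j le_i (or_intror e); rewrite !mxE; lra.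
Qed.

Theorem proposition5 (R : realType) (p q : nat) (hp : (0 < p)%N) (hq : (0 < q)%N)
    (tu : 'rV[R]_p) (tv : 'rV[R]_q)
    (tu_gt0 : forall i : 'I_p, 0 < tu 0 i)
    (tv_gt0 : forall j : 'I_q, 0 < tv 0 j)
    (tu_incr : forall i i' : 'I_p, (i < i')%N -> tu 0 i < tu 0 i')
    (tv_incr : forall j j' : 'I_q, (j < j')%N -> tv 0 j < tv 0 j')
    (tu_last : ext0 tu ord_max = (p * q)%:R)
    (tv_last : ext0 tv ord_max = (p * q)%:R)
    (C : gridType R p * gridType R q -> unitType R) :
  ASA tu tv (samples C) <->
  exists x : 'M[R]_(p, q),
    alt_transportation (increments tu) (increments tv) x /\
    forall (i : 'I_p.+1) (j : 'I_q.+1),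
      samples C i j =
        1 / (p * q)%:R *
        \sum_(l < p | (l < i)%N) \sum_(h < q | (h < j)%N) x l h.
Proof.
have tu_step := ext0_step_lt tu_gt0 tu_incr.
have tv_step := ext0_step_lt tv_gt0 tv_incr.
have N_neq0 : (p * q)%:R != 0 :> R by rewrite pnatr_eq0 -lt0n muln_gt0 hp.
set c := samples C; split=> [c_ASA | [x [x_alt cE]]].
  have [c0 _ _] := c_ASA; have [c0r c0c] := c0.
  pose x : 'M[R]_(p, q) := \matrix_(l, h) ((p * q)%:R *
    ((c (lift ord0 l) (lift ord0 h) - c (lift ord0 l) (widen_ord (leqnSn q) h)) -
     (c (widen_ord (leqnSn p) l) (lift ord0 h) -
      c (widen_ord (leqnSn p) l) (widen_ord (leqnSn q) h)))).
  have x_col (i : 'I_p.+1) k : \sum_(l < p | (l < i)%N) x l k =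
      (p * q)%:R * (c i (lift ord0 k) - c i (widen_ord (leqnSn q) k)).
    under eq_bigr do rewrite mxE.
    rewrite -mulr_sumr.
    rewrite (telescope_ord (fun i => c i (lift ord0 k) - c i (widen_ord _ k))).
    by rewrite !c0r !subr0.
  have x_row (j : 'I_q.+1) k : \sum_(h < q | (h < j)%N) x k h =
      (p * q)%:R * (c (lift ord0 k) j - c (widen_ord (leqnSn p) k) j).
    (* The entries of [x] are grouped for telescoping down a column; along a row they are regrouped
       as steps of [f]. *)
    pose f j' := c (lift ord0 k) j' - c (widen_ord (leqnSn p) k) j'.
    have f0 : f ord0 = 0 by rewrite /f !c0c subrr.
    have := telescope_ord f j; rewrite f0 subr0 -/(f j) => <-; rewrite mulr_sumr.
    by apply: eq_bigr => h _; rewrite mxE /f; congr (_ * _); lra.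
  exists x; split; first exact/(ASA_alt_transportation hp hq tu_step tv_step c0 x_col).
  move=> i j; under eq_bigr do rewrite x_row.
  rewrite -mulr_sumr (telescope_ord (fun i => c i j)) c0r subr0.
  by rewrite mulrA div1r mulVf ?mul1r.
have NcE (i : 'I_p.+1) (j : 'I_q.+1) : (p * q)%:R * c i j =
    \sum_(l < p | (l < i)%N) \sum_(h < q | (h < j)%N) x l h.
  by rewrite cE div1r mulVKf.
apply/(ASA_alt_transportation (x := x)) => //.
- split=> [j|i]; apply: (mulfI N_neq0); rewrite NcE mulr0.
    by rewrite big_pred0.
  by rewrite big1 // => l _; rewrite big_pred0.
(* With the column sum outermost, the difference of adjacent columns leaves a single partial column
   sum. *)
- move=> i k; rewrite mulrBr !NcE exchange_big [X in _ = _ - X]exchange_big /=.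
  by rewrite (sum_ltn_step (fun h => \sum_(l < p | (l < i)%N) x l h)).
- move=> j k; rewrite mulrBr !NcE.
  by rewrite (sum_ltn_step (fun l => \sum_(h < q | (h < j)%N) x l h)).
Qed.
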